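(* Let $f$ be a left interval-specification on $(\Omega,\mathcal{F})$, $\mu$ an extreme point of $\mathcal{G}(f)$ and $(\Lambda_n)_{n\ge1}$ a sequence in $\mathcal{S}_b$ such that $\Lambda_n\uparrow\mathbb{Z}$. Then: (a) $f_{\Lambda_n}h\to\mu(h)$ $\mu$-almost surely as $n\to\infty$, for each bounded local function $h$ on $\Omega$. (b) If $\Omega$ is a compact metric space, then for $\mu$-almost all $\omega\in\Omega$, $(f_{\Lambda_n}h)(\omega)\to\mu(h)$ for all continuous local functions $h$ on $\Omega$.
   Context: Let $(E,\mathcal{E})$ be a measurable space and $\Omega\subset E^{\mathbb{Z}}$ a set of (admissible) configurations, endowed with the $\sigma$-algebra $\mathcal{F}$ which is the restriction to $\Omega$ of the product $\sigma$-algebra. When topological notions are invoked, $E$ is a topological space, $\mathcal{E}$ its Borel $\sigma$-algebra, and $\Omega$ carries the restriction of the product topology. For $\Lambda\subset\mathbb{Z}$, $\mathcal{F}_\Lambda\subset\mathcal{F}$ is the $\sigma$-algebra generated by the coordinates $\omega\mapsto\omega_i$, $i\in\Lambda$; $\mathcal{F}_{\le n}=\mathcal{F}_{]-\infty,n]}$. $\mathcal{S}_b$ is the set of (nonempty) finite intervals of $\mathbb{Z}$; for $\Lambda\in\mathcal{S}_b$, $l_\Lambda=\min\Lambda$, $m_\Lambda=\max\Lambda$, $\Lambda_-=\,]-\infty,l_\Lambda-1]$. A left interval-specification (LIS) on $(\Omega,\mathcal{F})$ is a family $f=\{f_\Lambda\}_{\Lambda\in\mathcal{S}_b}$ of probability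 kernels $f_\Lambda:\mathcal{F}_{\le m_\Lambda}\times\Omega\to[0,1]$ (so $f_\Lambda(\cdot\mid\omega)$ is a probability measure on $(\Omega,\mathcal{F}_{\le m_\Lambda})$) such that for all $\Lambda\in\mathcal{S}_b$: (a) for each $A\in\mathcal{F}_{\le m_\Lambda}$, $f_\Lambda(A\mid\cdot)$ is $\mathcal{F}_{\Lambda_-}$-measurable; (b) for each $B\in\mathcal{F}_{\Lambda_-}$ and $\omega\in\Omega$, $f_\Lambda(B\mid\omega)=\mathbf{1}_B(\omega)$; (c) for each $\Delta\in\mathcal{S}_b$ with $\Delta\supset\Lambda$, $f_\Delta f_\Lambda=f_\Delta$ on $\mathcal{F}_{\le m_\Lambda}$, i.e. $\int\!\int h(\xi)f_\Lambda(d\xi\mid\sigma)f_\Delta(d\sigma\mid\omega)=\int h(\sigma)f_\Delta(d\sigma\mid\omega)$ for each $\mathcal{F}_{\le m_\Lambda}$-measurable $h$ and each $\omega\in\Omega$. We write $(f_\Lambda h)(\omega)=f_\Lambda(h\mid\omega)=\int h(\sigma)f_\Lambda(d\sigma\mid\omega)$. A probability measure $\mu$ on $(\Omega,\mathcal{F})$ is consistent with $f$ if $\mu f_\Lambda=\mu$ on $\mathcal{F}_{\le m_\Lambda}$ for every $\Lambda\in\mathcal{S}_b$, where $(\mu f_\Lambda)(A)=\int f_\Lambda(A\mid\omega)\mu(d\omega)$. $\mathcal{G}(f)$ denotes the (convex) set of all such measures. A local function is one that is $\mathcal{F}_\Delta$-measurable for some $\Delta\in\mathcal{S}_b$. $\Lambda_n\uparrow\mathbb{Z}$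 means $\Lambda_n\subset\Lambda_{n+1}$ and $\bigcup_n\Lambda_n=\mathbb{Z}$; $f_{\Lambda_n}h$ is defined as soon as $h$ is $\mathcal{F}_{\le m_{\Lambda_n}}$-measurable, i.e. for all large $n$. $\mu(h)=\int h\,d\mu$. *)

(* Defs.v *)
From HB Require Import structures.
From mathcomp Require Import all_boot all_order all_algebra.
From mathcomp Require Import all_classical all_reals all_analysis.
From mathcomp Require Import measurable_realfun.

Set Implicit Arguments.
Unset Strict Implicit.
Unset Printing Implicit Defensive.

Import Order.TTheory GRing.Theory Num.Theory.
Import numFieldNormedType.Exports.

Local Open Scope classical_set_scope.
Local Open Scope ring_scope.
Local Open Scope ereal_scope.

(* [finint] is the set S_b of nonempty finite intervals of Z; an interval is
   determined by, and given as, its endpoints. *)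
Record finint := FinInt {
  imin : int;
  imax : int;
  imin_le_imax : (imin <= imax)%R }.

Definition finint_set (L : finint) : set int :=
  [set i | (imin L <= i <= imax L)%R].
Coercion finint_set : finint >-> set.

Definition before (L : finint) : set int := [set i | (i < imin L)%R].

Definition upto (L : finint) : set int := [set i | (i <= imax L)%R].

(* Measurable types are pointed in MathComp-Analysis, hence nonemptiness.  This
   loses nothing: there is no probability measure on the empty space. *)
Record configSpace (E : Type) := ConfigSpace {
  admissible :> set (int -> E);
  admissible_nonempty : admissible !=set0 }.

Section configurations.
Context {d : measure_display} {E : measurableType d} (Omega : configSpace E).

Definition conf : Type := set_type Omega.

HB.instance Definition _ := Choice.copy conf (set_type Omega).
HB.instance Definition _ := isPointed.Build conf
  (SigSub (mem_set (projT2 (cid (admissible_nonempty Omega))))).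

Definition coord (i : int) (w : conf) : E := set_val w i.

Definition coord_events (L : set int) : set (set conf) :=
  \bigcup_(i in L) preimage_set_system [set: conf] (coord i) measurable.

(* [confF L] is Omega equipped with F_L; in particular
   [confF [set: int]] is (Omega, F), see [confFT_trace]. *)
Definition confF (L : set int) := g_sigma_algebraType (coord_events L).

Definition product_sigma_algebra : set (set (int -> E)) :=
  <<s \bigcup_(i in [set: int])
        preimage_set_system [set: int -> E] (fun x => x i) measurable >>.

Lemma confFT_trace :
  @measurable _ (confF [set: int]) =
  preimage_set_system [set: conf] set_val product_sigma_algebra.
Proof.
rewrite /product_sigma_algebra -g_sigma_preimageE.
rewrite [LHS]/measurable/=; congr (<<s _ >>).
apply/seteqP; split=> [A [i _ [B mB <-]]|_ [_ [i _ [B mB <-]] <-]].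
  exists ((fun x : int -> E => x i) @^-1` B); last by [].
  by exists i => //; exists B => //; rewrite setTI.
by exists i => //; exists B => //; rewrite !setTI.
Qed.

End configurations.

Arguments confF {d E} Omega L.

Section specifications.
Context {d : measure_display} {E : measurableType d} {Omega : configSpace E}.
Context {R : realType}.

(* Left interval-specifications.  The F_(L_-)-measurability of f_L(A | .) for A
   in F_(<= m_L) is the measurability clause of the kernel [lis_kernel L].  In
   [lis_compat], h ranges over nonnegative functions, for which all the
   integrals are defined. *)
Record lis := Lis {
  lis_kernel :> forall L : finint,
    R.-pker (confF Omega (before L)) ~> (confF Omega (upto L));
  lis_proper : forall (L : finint) (B : set (confF Omega (before L))),
    measurable B ->
    forall w, lis_kernel L w B = (\1_B w)%:E;
  lis_compat : forall L D : finint, L `<=` D ->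
    forall h : confF Omega (upto L) -> \bar R, (forall s, 0 <= h s) ->
    measurable_fun [set: confF Omega (upto L)] h ->
    forall w, \int[lis_kernel D w]_s (\int[lis_kernel L s]_x h x) =
              \int[lis_kernel D w]_s h s }.

Definition consistent (f : lis) : set (probability (confF Omega [set: int]) R) :=
  [set mu : probability (confF Omega [set: int]) R |
    forall (L : finint) (A : set (confF Omega (upto L))),
      measurable A -> \int[mu]_w (f L w A) = mu A].

Definition eq_prob (mu nu : probability (confF Omega [set: int]) R) : Prop :=
  forall A : set (confF Omega [set: int]), measurable A -> mu A = nu A.

Definition extreme_point (G : set (probability (confF Omega [set: int]) R))
    (mu : probability (confF Omega [set: int]) R) : Prop :=
  G mu /\
  forall nu1 nu2, G nu1 -> G nu2 -> forall t : R, (0 < t < 1)%R ->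
    (forall A : set (confF Omega [set: int]), measurable A ->
       mu A = t%:E * nu1 A + (1 - t)%:E * nu2 A) ->
    eq_prob nu1 mu /\ eq_prob nu2 mu.

Definition local_fun (h : conf Omega -> R) : Prop :=
  exists D : finint, measurable_fun [set: confF Omega D] h.

End specifications.

Arguments lis {d E} Omega R.

Definition increases_to_Z (L : nat -> finint) : Prop :=
  (forall n, L n `<=` L n.+1) /\ \bigcup_n (L n : set int) = [set: int].

(* [Topological E] is the type of topological structures on the carrier E; the
   points below come with the subspace topology of the product topology. *)
Definition conf_top {d : measure_display} {E : measurableType d}
    (Omega : configSpace E) (topE : Topological E) : topologicalType :=
  set_type
    (Omega : set (prod_topology (fun _ : int => Topological.Pack topE))).

Definition borel_structure {d : measure_display} {E : measurableType d}
    (topE : Topological E) : Prop :=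
  @measurable d E = <<s @open (Topological.Pack topE) >>.

Definition metrizable (R : realType) (T : topologicalType) : Prop :=
  exists metT : Metric R T, @open T = @open (Metric.Pack metT).

(* Main.v *)
Require Import Defs.
From HB Require Import structures.
From mathcomp Require Import all_boot all_order all_algebra.
From mathcomp Require Import all_classical all_reals all_analysis.
From mathcomp Require Import measurable_realfun.
From mathcomp Require Import lra.

Set Implicit Arguments.
Unset Strict Implicit.
Unset Printing Implicit Defensive.

Import Order.TTheory GRing.Theory Num.Theory.
Import numFieldNormedType.Exports.

Local Open Scope classical_set_scope.
Local Open Scope ring_scope.
Local Open Scope ereal_scope.

(** Why the theorem is true.

    For a nonnegative h that is measurable with respect to F_(<= m_L),
    consistency and properness give, for every A in F_(L_-),
    the identity int_A f_L h dmu = int_A h dmu: the function f_L h is the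
    conditional expectation of h given F_(L_-) ([consistent_integral_before]).
    As L_n increases to Z, the sigma-algebras F_((L_n)_-) decrease, so that
    f_(L_n) h is a reversed martingale.  Two facts make it converge to mu h.

    Extremality makes mu trivial on the tail: if A lies in F_(L_-) for all L and
    0 < mu A < 1, then conditioning mu on A and on its complement gives two
    members of G(f) of which mu is a proper convex combination
    ([extreme_tail_trivial]).

    The reversed martingale obeys Doob's weak maximal inequality
    l * mu (sup_(n >= N) f_(L_n) h > l) <= mu h ([lis_maximal_inequality]).
    Now suppose mu h < l.  The event that f_(L_n) h > l infinitely often is a
    tail event, hence of measure 0 or 1; it is contained in the event of
    the maximal inequality, so measure 1 would force l <= mu h.  Therefore
    limsup f_(L_n) h <= mu h almost surely ([ae_eventually_le]).  Applying this
    to h + M and to M - h for a function h bounded by M yields (a).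

    For (b) a null set must be found that serves all continuous local functions
    at once.  On a compact metrizable space any set of continuous functions has
    a countable subset that is dense for uniform approximation
    ([countable_uniformly_dense]); (a) applied to such a subset of the
    continuous local functions gives the null set, and uniform limits inherit the
    convergence because all the f_(L_n) and mu have mass one
    ([cvg_local_uniform_closure]). *)

(** * Integration against kernels, conditional measures and measures of mass one *)

(** The formula for integrals against the composition of two kernels, where [m]
    is taken as a constant kernel and [k] as a kernel that forgets the first of
    its two arguments. *)
Lemma ge0_integral_pkernel d1 d2 (X : measurableType d1) (Y : measurableType d2)
    (R : realType) (m : probability X R) (k : R.-pker X ~> Y)
    (nu : {measure set Y -> \bar R}) :
  (forall A, measurable A -> \int[m]_x k x A = nu A) ->
  forall h : Y -> \bar R, (forall y, 0 <= h y) -> measurable_fun [set: Y] h ->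
  \int[m]_x \int[k x]_y h y = \int[nu]_y h y.
Proof.
move=> knu h h0 mh.
have := @integral_kcomp _ _ _ X X Y R (kprobability (measurable_cst (m : pprobability X R)))
  (kernel.kernel_snd k) point h h0 mh.
rewrite /= => <-.
by apply: eq_measure_integral => A mA _; rewrite -knu.
Qed.

Section condition.
Context d (T : measurableType d) (R : realType) (mu : probability T R).
Context (A : set T) (mA : measurable A).

(** The conditional probability given [A]; it is [mu] itself when [A] is null. *)
Definition conditioned : probability T R := mnormalize (mrestr mu mA) mu.

Lemma conditionedE B : mu A != 0 -> conditioned B = mu (B `&` A) * (fine (mu A))^-1%:E.
Proof.
move=> A0; rewrite /conditioned/= /mnormalize/= /mrestr/= !setTI (negbTE A0)/=.
by rewrite lt_eqF// (le_lt_trans (probability_le1 _ _))// ltry.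
Qed.

Lemma ge0_integral_conditioned h : mu A != 0 -> measurable_fun setT h ->
  (forall x, 0 <= h x) ->
  \int[conditioned]_x h x = (fine (mu A))^-1%:E * \int[mu]_(x in A) h x.
Proof.
move=> A0 mh h0.
have c0 : (0 <= (fine (mu A))^-1)%R by rewrite invr_ge0 fine_ge0.
(* The complement of A is null for the conditioned measure, which on subsets of A
   is a multiple of mu. *)
rewrite (@ge0_negligible_integral _ _ _ _ _ (~` A))//; last 2 first.
- exact: measurableC.
- by apply: etrans (conditionedE _ A0) _; rewrite setICl measure0 mul0e.
rewrite setTD setCK -(ge0_integral_mscale _ mA (NngNum c0))//; last exact: measurable_funTS.
apply: eq_measure_integral => B mB BA.
by apply: etrans (conditionedE _ A0) _; rewrite /mscale/= setIidl// muleC.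
Qed.

End condition.

Section bounded_means.
Context d (T : measurableType d) (R : realType) (m : {measure set T -> \bar R}).
Hypothesis m1 : m [set: T] = 1.

Lemma bounded_integrable (h : T -> R) (M : R) :
  measurable_fun setT h -> (forall x, `|h x| <= M)%R -> m.-integrable setT (EFin \o h).
Proof.
move=> mh hM; apply: measurable_bounded_integrable => //; first by rewrite m1 ltry.
exists M; split; first exact: num_real.
by move=> x Mx y _ /=; rewrite (le_trans (hM y))// ltW.
Qed.

Lemma mean_cst (c : R) : (\int[m]_x c)%R = c.
Proof. by rewrite Rintegral_cst// m1 mulr1. Qed.

Lemma mean_dist_le (h k : T -> R) (M N e : R) :
  measurable_fun setT h -> (forall x, `|h x| <= M)%R ->
  measurable_fun setT k -> (forall x, `|k x| <= N)%R ->
  (forall x, `|h x - k x| <= e)%R ->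
  (`|\int[m]_x h x - \int[m]_x k x| <= e)%R.
Proof.
move=> mh hM mk kN hke.
have ih := bounded_integrable mh hM.
have ik := bounded_integrable mk kN.
have mhk : measurable_fun setT (fun x => h x - k x)%R by exact: measurable_funB.
rewrite -RintegralB//; apply: le_trans (le_normr_Rintegral _ _) _ => //.
  exact: bounded_integrable hke.
rewrite -[leRHS]mean_cst; apply: le_Rintegral => //.
- apply: (@bounded_integrable _ e); first exact: measurableT_comp.
  by move=> x; rewrite normr_id.
- exact: (@bounded_integrable _ `|e|).
Qed.

Context (h : T -> R) (M : R).
Hypothesis mh : measurable_fun setT h.
Hypothesis hM : forall x, (`|h x| <= M)%R.

Lemma EFin_bounded_mean : \int[m]_x (h x)%:E = (\int[m]_x h x)%R%:E.
Proof.
by rewrite fineK//; apply: integrable_fin_num => //; exact: bounded_integrable hM.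
Qed.

Lemma bounded_meanD (c : R) :
  (\int[m]_x (h x + c) = \int[m]_x h x + c)%R.
Proof.
rewrite RintegralD//; last 2 first.
- exact: bounded_integrable hM.
- by apply: (@bounded_integrable _ `|c|).
by rewrite mean_cst.
Qed.

Lemma bounded_meanN : (\int[m]_x (- h x) = - \int[m]_x h x)%R.
Proof.
rewrite -mulN1r -RintegralZl//; last exact: bounded_integrable hM.
by under [RHS]eq_Rintegral do rewrite mulN1r.
Qed.

End bounded_means.

Lemma ae_imply d (T : measurableType d) (R : realType)
    (m : {measure set T -> \bar R}) (P Q : T -> Prop) :
  (forall x, P x -> Q x) -> {ae m, forall x, P x} -> {ae m, forall x, Q x}.
Proof. by move=> PQ; exact: filterS. Qed.

(** * Change of sigma-algebra and the reversed martingale property *)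

Section config.
Context d (E : measurableType d) (Omega : configSpace E) (R : realType).
Implicit Types A B D : set int.

Lemma measurable_confFS A B (S : set (conf Omega)) : A `<=` B ->
  @measurable _ (confF Omega A) S -> @measurable _ (confF Omega B) S.
Proof.
by move=> AB; apply: sub_sigma_algebra2 => U [i Ai Ui]; exists i => //; exact: AB.
Qed.

Lemma measurable_confFT A (S : set (conf Omega)) :
  @measurable _ (confF Omega A) S -> @measurable _ (confF Omega [set: int]) S.
Proof. exact: measurable_confFS. Qed.

(** The identity, as a measurable map onto the same configurations with fewer
    events.  The image of a measure under it is the restriction of that measure to
    the smaller sigma-algebra. *)
Definition forget A B (AB : A `<=` B) : confF Omega B -> confF Omega A := id.

Lemma measurable_forget A B (AB : A `<=` B) :
  measurable_fun [set: confF Omega B] (forget AB).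
Proof. by move=> _ S mS; rewrite setTI; exact: measurable_confFS mS. Qed.

HB.instance Definition _ A B (AB : A `<=` B) :=
  @isMeasurableFun.Build _ _ _ _ (forget AB) (measurable_forget AB).

Lemma measurable_fun_confFS A B d' (T : measurableType d') (h : conf Omega -> T) :
  A `<=` B -> @measurable_fun _ _ (confF Omega A) T setT h ->
  @measurable_fun _ _ (confF Omega B) T setT h.
Proof. by move=> AB mh; exact: (measurableT_comp mh (measurable_forget AB)). Qed.

Lemma measurable_fun_confFT A d' (T : measurableType d') (h : conf Omega -> T) :
  @measurable_fun _ _ (confF Omega A) T setT h ->
  @measurable_fun _ _ (confF Omega [set: int]) T setT h.
Proof. exact: measurable_fun_confFS. Qed.

Lemma ge0_integral_forget A B (m : probability (confF Omega B) R)
   (AB : A `<=` B) (h : confF Omega A -> \bar R) :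
  measurable_fun setT h -> (forall w, 0 <= h w) ->
  \int[distribution m (forget AB)]_w h w = \int[m]_w h w.
Proof.
move=> mh h0.
by rewrite ge0_integral_pushforward// preimage_setT.
Qed.

Context (f : lis Omega R).

(** Consistency speaks of events; monotone convergence extends it to nonnegative
    functions.  The restrictions of [mu] to F_(L_-) and to F_(<= m_L) are needed
    because the kernel goes from the one sigma-algebra to the other. *)
Lemma consistent_integral (mu : probability (confF Omega [set: int]) R) :
  consistent f mu ->
  forall (L : finint) (h : confF Omega (upto L) -> \bar R),
    measurable_fun setT h -> (forall w, 0 <= h w) ->
    \int[mu]_w \int[f L w]_s h s = \int[mu]_s h s.
Proof.
move=> cmu L h mh h0.
have bT : before L `<=` [set: int] by [].
have uT : upto L `<=` [set: int] by [].
rewrite -(ge0_integral_forget mu uT mh h0).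
rewrite -(ge0_integral_forget mu bT); last 2 first.
- apply: measurable_fun_integral_kernel => // U mU.
  exact: (measurable_kernel (f L)).
- by move=> w; exact: integral_ge0.
apply: ge0_integral_pkernel => // S mS.
rewrite ge0_integral_forget//; last exact: (measurable_kernel (f L)).
exact: cmu.
Qed.

Lemma before_upto (L : finint) : before L `<=` upto L.
Proof.
by move=> i /= iL; apply: ltW; apply: lt_le_trans iL (imin_le_imax L).
Qed.

(** An event before L is decided by the conditioning configuration: by properness
    it has probability 0 or 1 under [f L w]. *)
Lemma lis_integral_restrict (L : finint) (A : set (conf Omega))
    (h : confF Omega (upto L) -> \bar R) w :
  @measurable _ (confF Omega (before L)) A ->
  measurable_fun setT h -> (forall w, 0 <= h w) ->
  \int[f L w]_(s in A) h s = ((fun w => \int[f L w]_s h s) \_ A) w.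
Proof.
move=> mA mh h0.
have mA' : @measurable _ (confF Omega (upto L)) A.
  exact: measurable_confFS (@before_upto L) mA.
have fA (B : set (conf Omega)) :
    @measurable _ (confF Omega (before L)) B -> ~ B w -> f L w B = 0.
  by move=> mB nBw; rewrite lis_proper// indicE memNset.
rewrite patchE; case: ifPn => [/set_mem Aw|/negP nAw].
  rewrite [RHS](@ge0_negligible_integral _ (confF Omega (upto L)) R (f L w) setT (~` A))//.
  - by rewrite setTD setCK.
  - exact: measurableC.
  - by apply: fA; [exact: measurableC|apply].
rewrite (@ge0_negligible_integral _ (confF Omega (upto L)) R (f L w) A A)//.
- by rewrite setDv integral_set0.
- exact: measurable_funTS.
- by apply: fA => // Aw; apply: nAw; exact: mem_set.
Qed.

(** f_L h is a version of the conditional expectation of h given F_(L_-). *)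
Lemma consistent_integral_before (mu : probability (confF Omega [set: int]) R) :
  consistent f mu ->
  forall (L : finint) (A : set (conf Omega)) (h : confF Omega (upto L) -> \bar R),
    @measurable _ (confF Omega (before L)) A ->
    measurable_fun setT h -> (forall w, 0 <= h w) ->
    \int[mu]_(w in A) \int[f L w]_s h s = \int[mu]_(s in A) h s.
Proof.
move=> cmu L A h mA mh h0.
have mA' : @measurable _ (confF Omega (upto L)) A.
  exact: measurable_confFS (@before_upto L) mA.
rewrite [RHS]integral_mkcond -(consistent_integral cmu (L := L)); last 2 first.
- by apply/measurable_restrict => //; exact: measurable_funTS.
- by move=> w; exact: erestrict_ge0.
rewrite [LHS]integral_mkcond; apply: eq_integral => w _.
by rewrite -integral_mkcond lis_integral_restrict.
Qed.

End config.

(** * Triviality of the tail *)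

Section tail.
Context d (E : measurableType d) (Omega : configSpace E) (R : realType).
Context (f : lis Omega R) (mu : probability (confF Omega [set: int]) R).

(** Tail events come before every interval, so that the kernels leave them
    alone, and conditioning on one preserves consistency. *)
Lemma consistent_conditioned (A : set (confF Omega [set: int]))
    (mA : measurable A) :
  consistent f mu -> mu A != 0 ->
  (forall L : finint, @measurable _ (confF Omega (before L)) A) ->
  consistent f (conditioned mu mA).
Proof.
move=> cmu A0 tA L B mB.
have mB' : @measurable _ (confF Omega [set: int]) B by exact: measurable_confFT mB.
have -> : \int[conditioned mu mA]_w f L w B =
    (fine (mu A))^-1%:E * \int[mu]_(w in A) f L w B.
  apply: ge0_integral_conditioned => //.
  apply: (@measurable_fun_confFT _ _ _ (before L)) => //.
  exact: (measurable_kernel (f L)).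
rewrite conditionedE// muleC; congr (_ * _).
transitivity (\int[mu]_(w in A) \int[f L w]_s (\1_B s)%:E).
  by apply: eq_integral => w _; rewrite integral_indic// setIT.
rewrite (consistent_integral_before cmu)//; last exact/measurable_EFinP.
by rewrite integral_indic.
Qed.

(** With t = mu A, mu is t times its conditioning on A plus 1 - t times its
    conditioning on the complement; extremality identifies the first with mu,
    although it gives A mass 1. *)
Lemma extreme_tail_trivial (A : set (conf Omega)) :
  extreme_point (consistent f) mu ->
  (forall L : finint, @measurable _ (confF Omega (before L)) A) ->
  mu A = 0 \/ mu A = 1.
Proof.
move=> [cmu emu] tA.
have mA : @measurable _ (confF Omega [set: int]) A.
  exact: measurable_confFT (tA (FinInt (lexx 0%R))).
have mCA : @measurable _ (confF Omega [set: int]) (~` A) by exact: measurableC.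
have [A0|A0] := eqVneq (mu A) 0; first by left.
right; apply/eqP; apply: contraPT isT => A1.
have fA : mu A \is a fin_num by exact: fin_num_measure.
have CAE : mu (~` A) = 1 - mu A by exact: probability_setC.
have CA0 : mu (~` A) != 0.
  by rewrite CAE; apply: contra A1; rewrite sube_eq// add0e eq_sym.
have fCAE : fine (mu (~` A)) = (1 - fine (mu A))%R by rewrite CAE -(fineK fA).
have fA0 : fine (mu A) != 0%R by rewrite fine_eq0.
have fCA0 : fine (mu (~` A)) != 0%R by rewrite fine_eq0// fin_num_measure.
have t01 : (0 < fine (mu A) < 1)%R.
  apply/andP; split; first by rewrite lt_neqAle eq_sym fA0 fine_ge0.
  by rewrite -subr_gt0 -fCAE lt_neqAle eq_sym fCA0 fine_ge0.
have c1 := consistent_conditioned mA cmu A0 tA.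
have c2 := consistent_conditioned mCA cmu CA0 (fun L => measurableC (tA L)).
have [|+ _] := emu _ _ c1 c2 _ t01.
  move=> B mB; rewrite !conditionedE// -fCAE.
  rewrite muleCA -EFinM divff// mule1 muleCA -EFinM divff// mule1.
  rewrite -measureU//; last 3 first.
  - exact: measurableI.
  - exact: measurableI.
  - by rewrite setIACA setICr setI0.
  by rewrite -setIUr setUCr setIT.
move=> /(_ A mA); rewrite conditionedE// setIid -{1}(fineK fA) -EFinM divff//.
by move=> /esym/eqP; rewrite (negbTE A1).
Qed.

End tail.

(** * The maximal inequality *)

Section maximal.
Context d (E : measurableType d) (Omega : configSpace E) (R : realType).
Context (f : lis Omega R) (mu : probability (confF Omega [set: int]) R).
Context (L : nat -> finint).

Hypothesis cmu : consistent f mu.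
Hypothesis LS : forall n, L n `<=` L n.+1.

Lemma increasing_imin m n : (m <= n)%N -> (imin (L n) <= imin (L m))%R.
Proof.
elim: n => [|n IH]; first by rewrite leqn0 => /eqP ->.
rewrite leq_eqVlt => /predU1P[-> //|/IH]; apply: le_trans.
have := @LS n (imin (L n)); rewrite /finint_set/= lexx imin_le_imax.
by move=> /(_ isT) /andP[].
Qed.

Lemma increasing_before m n : (m <= n)%N -> before (L n) `<=` before (L m).
Proof. by move=> mn i /= /lt_le_trans; apply; exact: increasing_imin. Qed.

Context (h : conf Omega -> \bar R).
Hypothesis mh : forall n, @measurable_fun _ _ (confF Omega (upto (L n))) _ setT h.
Hypothesis h0 : forall w, 0 <= h w.
Context (l : R).

Let S n := [set w : conf Omega | l%:E < \int[f (L n) w]_s h s].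

Lemma measurable_lis_gt n : @measurable _ (confF Omega (before (L n))) (S n).
Proof.
have : @measurable_fun _ _ (confF Omega (before (L n))) _ setT
    (fun w => \int[f (L n) w]_s h s).
  by apply: measurable_fun_integral_kernel => // U mU; exact: (measurable_kernel (f (L n))).
move=> /(emeasurable_fun_o_infty measurableT)/(_ l%:E).
by rewrite setTI.
Qed.

Let mS m n : (m <= n)%N -> @measurable _ (confF Omega (before (L m))) (S n).
Proof.
by move=> mn; apply: measurable_confFS (increasing_before mn) _; exact: measurable_lis_gt.
Qed.

Let mST n : @measurable _ (confF Omega setT) (S n).
Proof. exact: measurable_confFT (@measurable_lis_gt n). Qed.

Let F N m := \bigcup_(n in [set n | (N <= n < N + m)%N]) S n.

Let mF N m : @measurable _ (confF Omega (before (L N))) (F N m).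
Proof. by apply: bigcup_measurable => n /= /andP[Nn _]; exact: mS. Qed.

Let mFT N m : @measurable _ (confF Omega setT) (F N m).
Proof. exact: measurable_confFT (@mF N m). Qed.

Let F0 N : F N 0 = set0.
Proof.
by rewrite -subset0 => w [n /=]; rewrite addn0 => /andP[/leq_ltn_trans /[apply]]; rewrite ltnn.
Qed.

(* Splitting off the event that the last exceedance is at time N.  As the
   sigma-algebras decrease with n, this event still belongs to F_((L_N)_-). *)
Let FS N m : F N m.+1 = F N.+1 m `|` (S N `\` F N.+1 m).
Proof.
rewrite setUC setUDl setDv setD0; apply/seteqP; split=> [w [n /=]|w [Sw|[n /=]]].
- rewrite leq_eqVlt => /andP[/predU1P[->|Nn]] nm Sw; [by left|right].
  by exists n => //=; rewrite Nn addSnnS.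
- by exists N => //=; rewrite leqnn -addSnnS leq_addr.
- rewrite addSnnS => /andP[Nn nm] Sw; exists n => //=.
  by rewrite nm ltnW.
Qed.

Let mhT : @measurable_fun _ _ (confF Omega setT) _ setT h.
Proof. exact: (@measurable_fun_confFT _ _ _ (upto (L 0))). Qed.

Hypothesis l0 : (0 <= l)%R.

(** Decomposition over the last exceedance: on the event that it happens at time
    N, the integral of h equals that of f_(L_N) h, which is above the level. *)
Lemma finite_maximal_inequality N m :
  l%:E * mu (F N m) <= \int[mu]_(w in F N m) h w.
Proof.
elim: m N => [|m IH] N; first by rewrite F0 measure0 mule0 integral_set0.
rewrite FS; set U := F N.+1 m.
have mU : @measurable _ (confF Omega (before (L N))) U.
  by apply: measurable_confFS (increasing_before (leqnSn N)) (@mF N.+1 m).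
have mUT : @measurable _ (confF Omega setT) U by exact: measurable_confFT mU.
have mV : @measurable _ (confF Omega (before (L N))) (S N `\` U).
  by apply: measurableD => //; exact: mS.
have mVT : @measurable _ (confF Omega setT) (S N `\` U) by exact: measurable_confFT mV.
have UV : [disjoint U & S N `\` U] by apply/disj_setPS => x [? []].
rewrite measureU//; last by apply/disj_set2P.
rewrite ge0_muleDr// ge0_integral_setU//; last first.
  by apply: measurable_funTS.
apply: leeD; first exact: IH.
rewrite -(consistent_integral_before cmu (L := L N) mV (@mh N) h0).
rewrite -(integral_cst mu mVT l%:E).
apply: ge0_le_integral => //.
- apply: measurable_funTS.
  apply: (@measurable_fun_confFT _ _ _ (before (L N))) => //.
  by apply: measurable_fun_integral_kernel => // W mW; exact: (measurable_kernel (f (L N))).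
- by move=> w [/ltW].
Qed.

(** Doob's weak maximal inequality for the reversed martingale f_(L_n) h. *)
Lemma lis_maximal_inequality N : l%:E * mu (\bigcup_(n >= N) S n) <= \int[mu]_w h w.
Proof.
have FE : \bigcup_m F N m = \bigcup_(n >= N) S n.
  apply/seteqP; split=> [w [m _ [n /= /andP[Nn _] Sw]]|w [n /= Nn Sw]].
    by exists n.
  by exists n.+1 => //; exists n => //=; rewrite Nn ltn_addl.
have cF : l%:E * mu (F N m) @[m --> \oo] --> l%:E * mu (\bigcup_(n >= N) S n).
  apply: cvgeZl => //; rewrite -FE; apply: nondecreasing_cvg_mu => //.
    exact: bigcup_measurable.
  move=> m n mn; apply/subsetPset.
  by move=> w [k /= /andP[Nk km] Sw]; exists k => //=; rewrite Nk (leq_trans km)// leq_add2l.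
rewrite -(cvg_lim _ cF)//; apply: lime_le; first exact: cvgP cF.
apply: nearW => m; apply: le_trans (finite_maximal_inequality N m) _.
by apply: ge0_subset_integral.
Qed.

End maximal.

(** * Almost sure convergence for bounded functions *)

Section eventually.
Context d (E : measurableType d) (Omega : configSpace E) (R : realType).
Context (f : lis Omega R) (mu : probability (confF Omega [set: int]) R).

Lemma increasing_bounds (L : nat -> finint) (D : finint) : increases_to_Z L ->
  exists N, forall n : nat, (N <= n)%N ->
    (imin (L n) <= imin D)%R /\ (imax D <= imax (L n))%R.
Proof.
move=> [LS LT].
have sub m n : (m <= n)%N -> (L m : set int) `<=` L n.
  elim: n => [|n IH]; first by rewrite leqn0 => /eqP ->.
  rewrite leq_eqVlt => /predU1P[-> //|/IH mn]; exact: subset_trans mn (LS n).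
have ex i : exists m, (L m : set int) i.
  by have : [set: int] i by []; rewrite -LT => -[m _ Lmi]; exists m.
have [m1 D1] := ex (imin D); have [m2 D2] := ex (imax D).
exists (maxn m1 m2) => n; rewrite geq_max => /andP[mn1 mn2].
have /andP[? _] := sub _ _ mn1 _ D1; have /andP[_ ?] := sub _ _ mn2 _ D2.
by split.
Qed.

Context (L : nat -> finint).
Hypothesis emu : extreme_point (consistent f) mu.
Hypothesis LZ : increases_to_Z L.

(** Exceeding the level infinitely often is a tail event, so null or almost sure.
    In the latter case some exceedance happens almost surely, and the maximal
    inequality puts the level below [mu h]. *)
Lemma ae_eventually_le (h : conf Omega -> \bar R) (l : R) :
  (forall n, @measurable_fun _ _ (confF Omega (upto (L n))) _ setT h) ->
  (forall w, 0 <= h w) -> \int[mu]_w h w < l%:E ->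
  {ae mu, forall w, \forall n \near \oo, \int[f (L n) w]_s h s <= l%:E}.
Proof.
move=> mh h0 hl; have [cmu _] := emu; have [LS _] := LZ.
have l0 : (0 <= l)%R.
  by rewrite -lee_fin ltW// (le_lt_trans _ hl)// integral_ge0.
(* The exceedance events; their upper limit does not depend on finitely many of
   them, hence is a tail event. *)
pose S n := [set w : conf Omega | l%:E < \int[f (L n) w]_s h s].
have mS n : @measurable _ (confF Omega (before (L n))) (S n).
  exact: measurable_lis_gt.
have tS (D : finint) : @measurable _ (confF Omega (before D)) (lim_sup_set S).
  have [N HN] := increasing_bounds D LZ.
  have -> : lim_sup_set S = \bigcap_n \bigcup_(j in [set j | (n + N <= j)%N]) S j.
    apply/seteqP; split=> w Sw n _; have := Sw.
      by move=> /(_ (n + N)%N I).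
    by move=> /(_ n I) [j /= nj Sj]; exists j => //=; apply: leq_trans nj; exact: leq_addr.
  apply: bigcapT_measurable => n; apply: bigcup_measurable => j /= nj.
  apply: measurable_confFS (mS j) => i /= /lt_le_trans; apply.
  by apply: (HN j _).1; apply: leq_trans nj; exact: leq_addl.
have mlim : @measurable _ (confF Omega [set: int]) (lim_sup_set S).
  exact: measurable_confFT (tS (L 0)).
have mST n : @measurable _ (confF Omega [set: int]) (S n).
  exact: measurable_confFT (mS n).
have mulim : mu (lim_sup_set S) = 0.
  have [//|S1] := extreme_tail_trivial emu tS.
  suff : l%:E <= \int[mu]_w h w by rewrite leNgt hl.
  apply: le_trans (lis_maximal_inequality cmu LS mh h0 l0 0).
  rewrite -{1}(mule1 l%:E) -S1; apply: lee_wpmul2l; first by rewrite lee_fin.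
  exact: lim_sup_set_ub.
exists (lim_sup_set S); split=> // w /= nle n _.
apply: contrapT => nS; apply: nle; exists n => // j /= nj.
by rewrite leNgt; apply/negP => Sj; apply: nS; exists j.
Qed.

(** The bound M is added to h to make it nonnegative; kernels and [mu] have mass
    one, so it cancels. *)
Lemma ae_eventually_le_bounded (h : conf Omega -> R) (M e : R) :
  (forall n, @measurable_fun _ _ (confF Omega (upto (L n))) _ setT h) ->
  (forall w, `|h w| <= M)%R -> (0 < e)%R ->
  {ae mu, forall w, \forall n \near \oo,
     (\int[f (L n) w]_s h s <= \int[mu]_s h s + e)%R}.
Proof.
move=> mh hM e0.
have mu1 : mu setT = 1 by exact: probability_setT.
have f1 n w : f (L n) w setT = 1 by exact: prob_kernel.
have mhT : @measurable_fun _ _ (confF Omega setT) _ setT h.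
  exact: (@measurable_fun_confFT _ _ _ (upto (L 0))).
have hM2 w : (`|h w + M| <= M + M)%R.
  rewrite (le_trans (ler_normD _ _))// lerD// ger0_norm//.
  exact: le_trans (hM w).
have mhM n : @measurable_fun _ _ (confF Omega (upto (L n))) _ setT (fun w => h w + M)%R.
  exact: measurable_funD.
have mhMT : @measurable_fun _ _ (confF Omega setT) _ setT (fun w => h w + M)%R.
  exact: measurable_funD.
have := @ae_eventually_le (fun w => (h w + M)%:E) (\int[mu]_s h s + M + e)%R.
case.
- by move=> n; apply/measurable_EFinP.
- by move=> w; rewrite lee_fin -lerBlDr sub0r; have := hM w; rewrite ler_norml => /andP[].
- by rewrite (EFin_bounded_mean mu1 mhMT hM2) (bounded_meanD mu1 mhT hM) lte_fin ltrDl.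
- move=> N [mN N0 sN]; exists N; split=> // w /= nle; apply: sN => /= le; apply: nle.
  apply: filterS le => n.
  rewrite (EFin_bounded_mean (f1 n w) (@mhM n) hM2).
  by rewrite (bounded_meanD (f1 n w) (@mh n) hM) lee_fin addrAC lerD2r.
Qed.

Lemma ae_cvg_bounded (h : conf Omega -> R) (M : R) :
  (forall n, @measurable_fun _ _ (confF Omega (upto (L n))) _ setT h) ->
  (forall w, `|h w| <= M)%R ->
  {ae mu, forall w, (\int[f (L n) w]_s h s)%R @[n --> \oo] --> (\int[mu]_s h s)%R}.
Proof.
move=> mh hM.
have mu1 : mu setT = 1 by exact: probability_setT.
have f1 n w : f (L n) w setT = 1 by exact: prob_kernel.
have mhT : @measurable_fun _ _ (confF Omega setT) _ setT h.
  exact: (@measurable_fun_confFT _ _ _ (upto (L 0))).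
have mNh n : @measurable_fun _ _ (confF Omega (upto (L n))) _ setT (\- h)%R.
  exact: measurable_funN.
have NhM w : (`|(\- h) w| <= M)%R by rewrite /= normrN.
have p0 p : (0 < p.+1%:R^-1 :> R)%R by [].
have /ae_foralln A1 := fun p => ae_eventually_le_bounded mh hM (p0 p).
have /ae_foralln A2 := fun p => ae_eventually_le_bounded mNh NhM (p0 p).
apply: filterS2 A1 A2 => w H1 H2.
apply/cvgrPdist_le => e e0.
have [p pe] : exists p, (p.+1%:R^-1 < e)%R.
  by have [p] := ltr_add_invr e0; rewrite add0r; exists p.
near=> n.
have le1 : (\int[f (L n) w]_s h s <= \int[mu]_s h s + p.+1%:R^-1)%R.
  by near: n; exact: H1.
have : (\int[f (L n) w]_s (- h s) <= \int[mu]_s (- h s) + p.+1%:R^-1)%R.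
  by near: n; exact: H2.
rewrite (bounded_meanN mu1 mhT hM) (bounded_meanN (f1 n w) (@mh n) hM) => le2.
move: le2; rewrite lerNl opprD opprK lerBlDr => le2.
rewrite ler_distl lerBlDr; apply/andP; split; [apply: le_trans le1 _|apply: le_trans le2 _];
  by rewrite lerD2l ltW.
Unshelve. all: by end_near. Qed.

End eventually.

(** * Countable dense families of continuous functions *)

(** A point makes [T] a pointed space without changing its topology. *)
Lemma compact_cover_compact (T : topologicalType) :
  T -> @compact T setT -> @cover_compact T setT.
Proof.
move=> x0 cT; pose PT : ptopologicalType := HB.pack (T : Type) T (isPointed.Build T x0).
by have : @compact PT setT by []; rewrite compact_cover.
Qed.

(** Compactness and bases depend on the open sets only, so both transfer between
    [T] and the metric space that has the same open sets. *)
Lemma compact_metrizable_second_countable (R : realType) (T : topologicalType) :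
  T -> metrizable R T -> compact [set: T] -> @second_countable T.
Proof.
move=> x0 [metT openE] cT.
pose M : metricType R := Metric.Pack metT.
pose PM : pseudoPMetricType R :=
  HB.pack (Metric.sort M) (Metric.class M) (isPointed.Build (Metric.sort M) x0).
have cM : @compact PM setT.
  rewrite compact_cover => I D F oF DF.
  apply: (compact_cover_compact x0 cT (D := D) (f := F)) => // i Di; have := oF i Di.
  by rewrite openE.
have [B cB [oB bB]] := @compact_second_countable R PM cM.
exists B => //; split=> [U BU|x A].
  by rewrite openE; exact: oB.
rewrite nbhsE => -[U [oU Ux] UA].
have : @nbhs PM PM x U.
  rewrite nbhsE; exists U => //; split=> //.
  by rewrite openE in oU.
by move=> /bB [V BV VU]; exists V => //; exact: subset_trans VU UA.
Qed.

Lemma compact_continuous_bounded (R : realType) (T : topologicalType) (h : T -> R) :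
  compact [set: T] -> continuous h -> exists M, forall x, (`|h x| <= M)%R.
Proof.
move=> cT ch.
have : compact (h @` setT) by apply: continuous_compact => //; exact: continuous_subspaceT.
move=> /compact_bounded[M [_ HM]]; exists (M + 1)%R => x.
by apply: HM; [rewrite ltrDl|exists x].
Qed.

(** A code is a precision 1/(p+1) together with a finite list of pairs made of a
    basic open set and an integer z, which prescribes the value z/(p+1) on the open
    set.  There are countably many codes; for each of them one function of [P] that
    fits it is chosen, if there is one.  By compactness every continuous function
    fits some code whose open sets cover the space, and two functions that fit
    such a code are uniformly close.  The approximants lie in [P] because they are
    chosen there, rather than built from the code. *)
Lemma countable_uniformly_dense (R : realType) (T : topologicalType) (P : set (T -> R)) :
  T -> compact [set: T] -> @second_countable T -> P !=set0 ->
  exists c : nat -> T -> R, (forall n, P (c n)) /\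
    forall h, P h -> continuous h -> forall e, (0 < e)%R ->
      exists n, forall x, (`|h x - c n x| <= e)%R.
Proof.
move=> x0 cT [B /countable_injP[f injf] [oB bB]] [k0 Pk0].
(* Basic open sets are referred to by their index under the injection f. *)
pose fits (s : nat * seq (nat * int)) : set (T -> R) :=
  [set k | forall b z, B b -> (f b, z) \in s.2 -> forall y, b y ->
    (`|k y - z%:~R * s.1.+1%:R^-1| <= 2 * s.1.+1%:R^-1)%R].
have /choice[c Hc] : forall n, exists k, P k /\
    forall s, unpickle n = Some s -> (exists k', P k' /\ fits s k') -> fits s k.
  move=> n; case: (unpickle n : option (nat * seq (nat * int))) => [s|]; last by exists k0.
  have [[k [Pk fk]]|nk] := pselect (exists k', P k' /\ fits s k').
    by exists k; split=> // _ [<-].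
  by exists k0; split=> // _ [<-].
exists c; split=> [n|h Ph ch e e0]; first exact: (Hc n).1.
(* Both functions lie within 2/(p+1) of the prescribed values. *)
have [p pe] : exists p, (4 * p.+1%:R^-1 < e)%R.
  have e4 : (0 < e / 4)%R by rewrite divr_gt0.
  have [p] := ltr_add_invr e4; rewrite add0r => pe; exists p.
  by rewrite mulrC -ltr_pdivlMr.
have p0 : (0 < p.+1%:R^-1 :> R)%R by [].
pose z x := Num.floor (h x * p.+1%:R).
have /choice[b Hb] : forall x, exists b, [/\ B b, b x & forall y, b y ->
   (`|h y - (z x)%:~R * p.+1%:R^-1| <= 2 * p.+1%:R^-1)%R].
  move=> x.
  have nx : nbhs x [set y | (`|h x - h y| < p.+1%:R^-1)%R].
    by have /cvgrPdist_lt := ch x; apply.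
  have [b [Bb bx] bn] := bB x _ nx; exists b; split=> // y by_.
  have hz : (`|h x - (z x)%:~R / p.+1%:R| <= p.+1%:R^-1)%R.
    have -> : (h x - (z x)%:~R / p.+1%:R = (h x * p.+1%:R - (z x)%:~R) / p.+1%:R)%R.
      by rewrite mulrBl mulfK.
    rewrite normrM [X in (_ * X)%R]ger0_norm ?ler_piMl ?ltW//.
    have /andP[fl1 fl2] := floor_itv (h x * p.+1%:R).
    by rewrite ger0_norm ?subr_ge0// ltrBlDl -intrD1.
  rewrite mulr2n mulrDl mul1r -(subrKA (h x)); apply: le_trans (ler_normD _ _) _.
  by apply: lerD => //; rewrite distrC; apply: ltW; exact: bn.
have [||D _ TD] := @compact_cover_compact T x0 cT T setT b.
- by move=> x _; apply: oB; case: (Hb x).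
- by move=> x _; exists x => //; case: (Hb x).
pose s := (p, [seq (f (b x), z x) | x <- finmap.enum_fset D]).
exists (pickle s) => x.
have fsh : fits s h.
  move=> b' z' Bb' /mapP[/= x' x'D [/injf fE ->]] y b'y.
  have [Bx' _ +] := Hb x'; apply.
  by rewrite -fE ?mem_set.
have fsc : fits s (c (pickle s)).
  by apply: (Hc _).2 (pickleK s) _; exists h.
have [x' /= x'D bx'x] := TD x I.
have [Bx' _ _] := Hb x'.
have sx' : (f (b x'), z x') \in s.2 by apply: map_f.
have h1 := fsh _ _ Bx' sx' _ bx'x; have h2 := fsc _ _ Bx' sx' _ bx'x.
apply: le_trans (ltW pe).
rewrite -(subrKA ((z x')%:~R * p.+1%:R^-1)); apply: le_trans (ler_normD _ _) _.
have -> : (4 = 2 + 2 :> R)%R by rewrite -natrD.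
by rewrite mulrDl lerD// distrC.
Qed.

(** * Local functions *)

Section local_limits.
Context d (E : measurableType d) (Omega : configSpace E) (R : realType).
Context (f : lis Omega R) (mu : probability (confF Omega [set: int]) R).
Context (L : nat -> finint).
Hypothesis emu : extreme_point (consistent f) mu.
Hypothesis LZ : increases_to_Z L.

(** From some N on, [L n] reaches beyond the interval that [h] depends on, and
    f_(L_n) h is a genuine integral. *)
Lemma local_fun_upto (h : conf Omega -> R) : local_fun h ->
  exists N, forall n, (N <= n)%N -> @measurable_fun _ _ (confF Omega (upto (L n))) _ setT h.
Proof.
move=> [D mh]; have [N HN] := increasing_bounds D LZ; exists N => n Nn.
apply: (measurable_fun_confFS _ mh) => i /= /andP[_ iD].
exact: le_trans iD (HN n Nn).2.
Qed.

Lemma local_fun_measurable (h : conf Omega -> R) : local_fun h ->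
  @measurable_fun _ _ (confF Omega [set: int]) _ setT h.
Proof. by move=> [D mh]; exact: (@measurable_fun_confFT _ _ _ D). Qed.

Lemma ae_cvg_local (h : conf Omega -> R) (M : R) :
  local_fun h -> (forall w, `|h w| <= M)%R ->
  {ae mu, forall w, (\int[f (L n) w]_s h s)%R @[n --> \oo] --> (\int[mu]_s h s)%R}.
Proof.
move=> lh hM; have [N mh] := local_fun_upto lh.
have LZN : increases_to_Z (fun n => L (n + N)%N).
  have [LS LT] := LZ; split=> [n|]; first exact: LS.
  apply/seteqP; split=> // i _.
  have [N' HN'] := increasing_bounds (FinInt (lexx i)) LZ.
  exists N' => //; have [/= li iu] := HN' (N' + N)%N (leq_addr _ _).
  by rewrite /finint_set/= li iu.
have H := @ae_cvg_bounded _ _ _ _ _ _ (fun n => L (n + N)%N) emu LZN h M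
  (fun n => mh (n + N)%N (leq_addl _ _)) hM.
apply: ae_imply H => w.
by rewrite -(cvg_shiftn N (fun n => (\int[f (L n) w]_s h s)%R)).
Qed.

Lemma local_cvg_EFin (h : conf Omega -> R) (M : R) w :
  local_fun h -> (forall w, `|h w| <= M)%R ->
  (\int[f (L n) w]_s h s)%R @[n --> \oo] --> (\int[mu]_s h s)%R ->
  \int[f (L n) w]_s (h s)%:E @[n --> \oo] --> \int[mu]_s (h s)%:E.
Proof.
move=> lh hM cvh; have [N mh] := local_fun_upto lh.
have mu1 : mu setT = 1 by exact: probability_setT.
rewrite (EFin_bounded_mean mu1 (local_fun_measurable lh) hM).
apply/fine_cvgP; split; last exact: cvh.
exists N => // n /= Nn.
rewrite (EFin_bounded_mean _ (mh n Nn) hM)//; exact: prob_kernel.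
Qed.

(** An epsilon/3 argument, at a fixed configuration [w]: integration against a
    measure of mass one is 1-Lipschitz for the uniform distance. *)
Lemma cvg_local_uniform_closure (w : conf Omega) (h : conf Omega -> R) (M : R) :
  local_fun h -> (forall w, `|h w| <= M)%R ->
  (forall e, (0 < e)%R -> exists (c : conf Omega -> R) (M' : R),
     [/\ local_fun c, forall w, (`|c w| <= M')%R, forall w, (`|h w - c w| <= e)%R &
     (\int[f (L n) w]_s c s)%R @[n --> \oo] --> (\int[mu]_s c s)%R]) ->
  (\int[f (L n) w]_s h s)%R @[n --> \oo] --> (\int[mu]_s h s)%R.
Proof.
move=> lh hM apx; apply/cvgrPdist_le => e e0.
have e3 : (0 < e / 3)%R by rewrite divr_gt0.
have [c [M' [lc cM hc cvc]]] := apx _ e3.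
have [N mh] := local_fun_upto lh; have [N' mc] := local_fun_upto lc.
have mu1 : mu setT = 1 by exact: probability_setT.
have muhc := mean_dist_le mu1 (local_fun_measurable lh) hM (local_fun_measurable lc) cM hc.
move/cvgrPdist_le : cvc => /(_ _ e3) cvc.
near=> n.
have f1 : f (L n) w setT = 1 by exact: prob_kernel.
have mhn : @measurable_fun _ _ (confF Omega (upto (L n))) _ setT h.
  by apply: mh; near: n; exact: nbhs_infty_ge.
have mcn : @measurable_fun _ _ (confF Omega (upto (L n))) _ setT c.
  by apply: mc; near: n; exact: nbhs_infty_ge.
have fhc := mean_dist_le f1 mhn hM mcn cM hc.
have fmuc : (`|\int[mu]_s c s - \int[f (L n) w]_s c s| <= e / 3)%R by near: n.
have -> : e = (e / 3 + (e / 3 + e / 3))%R by lra.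
rewrite -(subrKA (\int[mu]_s c s)%R); apply: le_trans (ler_normD _ _) _.
apply: lerD => //.
rewrite -(subrKA (\int[f (L n) w]_s c s)%R); apply: le_trans (ler_normD _ _) _.
by apply: lerD => //; rewrite distrC.
Unshelve. all: by end_near. Qed.

End local_limits.

Theorem theorem3p8 (R : realType) (d : measure_display) (E : measurableType d)
    (Omega : configSpace E) (f : lis Omega R)
    (mu : probability (confF Omega [set: int]) R) (L : nat -> finint) :
  extreme_point (consistent f) mu ->
  increases_to_Z L ->
  (forall h : conf Omega -> R, bounded_fun h -> local_fun h ->
     {ae mu, forall w : conf Omega,
        \int[f (L n) w]_s (h s)%:E @[n --> \oo] --> \int[mu]_s (h s)%:E}) /\
  (forall topE : Topological E, borel_structure topE ->
     compact [set: conf_top Omega topE] ->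
     metrizable R (conf_top Omega topE) ->
     {ae mu, forall w : conf Omega, forall h : conf Omega -> R,
        continuous (h : conf_top Omega topE -> R) -> local_fun h ->
        \int[f (L n) w]_s (h s)%:E @[n --> \oo] --> \int[mu]_s (h s)%:E}).
Proof.
move=> emu LZ; split=> [h bh lh|topE _ cT mT].
  have [M [_ HM]] := bh.
  have hM w : (`|h w| <= M + 1)%R by apply: HM => //; rewrite ltrDl.
  by apply: ae_imply (ae_cvg_local emu LZ lh hM) => w; exact: local_cvg_EFin hM.
have x0 : conf_top Omega topE := point : conf Omega.
have sT := compact_metrizable_second_countable x0 mT cT.
have bnd h := @compact_continuous_bounded R (conf_top Omega topE) h cT.
pose P : set (conf_top Omega topE -> R) :=
  [set h : conf_top Omega topE -> R | continuous h /\ local_fun (h : conf Omega -> R)].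
have P0 : P !=set0.
  exists (cst 0%R); split; first exact: cst_continuous.
  by exists (FinInt (lexx 0%R)); exact: measurable_cst.
have [c [Pc denc]] := countable_uniformly_dense x0 cT sT P0.
have /ae_foralln aec : forall n, {ae mu, forall w : conf Omega,
    (\int[f (L k) w]_s c n s)%R @[k --> \oo] --> (\int[mu]_s c n s)%R}.
  move=> n; have [M cM] := bnd _ (Pc n).1.
  exact: (ae_cvg_local (h := c n) emu LZ (Pc n).2 cM).
apply: ae_imply aec => w aec h ch lh.
have [M hM] := bnd _ ch.
apply: (local_cvg_EFin LZ lh hM); apply: (cvg_local_uniform_closure LZ lh hM) => e e0.
have [n hc] := denc h (conj ch lh) ch e e0.
have [M' cM'] := bnd _ (Pc n).1.
by exists (c n), M'; split => //; exact: (Pc n).2.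
Qed.
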